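(* Let $\phi$ be a satisfiable $\mathbf G_1(\mathbf F_q,\mathbf G_1,\vee)$-formula. Then $\phi$ has a model with at most $|\phi|$ states.
   Context: Fix a finite set $\mathcal A$ of atomic propositions. A Markov chain is $M=(S,P,s_0,L)$ with $S$ countable, $P:S\times S\to[0,1]$, $\sum_tP(s,t)=1$ for all $s$, initial state $s_0$, labeling $L:S\to2^{\mathcal A}$. $\mathbb P_{M(s)}$ is the standard probability measure on runs from $s$; $\pi[i]$ is the $i$-th state of run $\pi$. PCTL$(\mathbf F,\mathbf G)$ formulae: $a,\neg a$ ($a\in\mathcal A$), $\wedge,\vee$, $\mathbf F_{\rhd q}\varphi$, $\mathbf G_{\rhd q}\varphi$ ($\rhd\in\{\ge,>\}$, $q\in[0,1]\cap\mathbb Q$), with $M,s\models\mathbf F_{\rhd q}\varphi$ iff $\mathbb P_{M(s)}(\{\pi\mid\exists i: M,\pi[i]\models\varphi\})\rhd q$ and $M,s\models\mathbf G_{\rhd q}\varphi$ iff $\mathbb P_{M(s)}(\{\pi\mid\forall i:M,\pi[i]\models\varphi\})\rhd q$; literals via $L$, Boolean connectives as usual. $=1$ means $\ge1$. $M$ is a model of $\phi$ if $M,s_0\models\phi$; $\phi$ is satisfiable if it has a (countable) model. $|\phi|$ is the length of $\phi$. A $\mathbf G_1(\mathbf F_q,\mathbf G_1,\vee)$-formula is $\mathbf G_{=1}\Psi$ with $\Psi::=a\mid\neg a\mid\Psi\wedge\Psi\mid\Psi\vee\Psi\mid\mathbf F_{\rhd q}\Psi\mid\mathbf G_{=1}\Psi$.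 *)

(* Defs.v *)
From HB Require Import structures.
From mathcomp Require Import all_boot all_order all_algebra.
From mathcomp Require Import all_classical all_reals all_analysis.
From mathcomp Require Import ring lra.

Set Implicit Arguments.
Unset Strict Implicit.
Unset Printing Implicit Defensive.

Import Order.TTheory GRing.Theory Num.Theory.
Import numFieldNormedType.Exports.

Local Open Scope classical_set_scope.
Local Open Scope ring_scope.

Record markov_chain (R : realType) (A : finType) := MarkovChain {
  state : countType;
  trans : state -> state -> R;
  init : state;
  label : state -> {set A};
  trans_itv : forall s t, 0 <= trans s t <= 1;
  trans_sum : forall s, \esum_(t in [set: state]) (trans s t)%:E = 1%E }.

Arguments init {R A} m.

Definition run (R : realType) (A : finType) (M : markov_chain R A) : Type :=
  nat -> state M.

HB.instance Definition _ (R : realType) (A : finType) (M : markov_chain R A) :=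
  gen_eqMixin (run M).
HB.instance Definition _ (R : realType) (A : finType) (M : markov_chain R A) :=
  gen_choiceMixin (run M).
HB.instance Definition _ (R : realType) (A : finType) (M : markov_chain R A) :=
  isPointed.Build (run M) (fun=> init M).

Section RunSpace.
Variables (R : realType) (A : finType) (M : markov_chain R A).

(* The finite path w 0, ..., w n is given by an infinite sequence w of which
   only the first n.+1 entries matter. *)
Definition cylinder (w : run M) (n : nat) : set (run M) :=
  [set pi | forall i, (i <= n)%N -> pi i = w i].

Definition cylinders : set (set (run M)) :=
  [set C | exists w n, C = cylinder w n].

Definition run_space := g_sigma_algebraType cylinders.

HB.instance Definition _ := Measurable.on run_space.

Definition is_run_measure (s : state M) (mu : probability run_space R) : Prop :=
  forall (w : run M) (n : nat),
    mu (cylinder w n) =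
    ((w 0%N == s)%:R * \prod_(i < n) trans (w i) (w i.+1))%:E.

End RunSpace.
Arguments cylinders {R A} M.
Arguments run_space {R A} M.

(* The measure is the image of Lebesgue measure on [0, 1[ under the map that
   reads a run off a number u: in state s, [0, 1[ is cut into consecutive cells
   of length trans s t, u selects the cell of the next state t and is rescaled
   from this cell to [0, 1[. The preimage of a cylinder is then an interval. *)
Section RunMeasureExists.
Variables (R : realType) (A : finType) (M : markov_chain R A).
Local Notation S := (state M).
Implicit Types (s t : S) (u : R).

Lemma trans_ge0 s t : 0 <= trans s t.
Proof. by case/andP: (trans_itv s t). Qed.

Let c s (k : nat) : R := if pickle_inv k is Some t then trans s t else 0.

Let c_ge0 s k : 0 <= c s k.
Proof. by rewrite /c; case: pickle_inv => // t; exact: trans_ge0. Qed.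

Let cpickle s t : c s (pickle t) = trans s t.
Proof. by rewrite /c pickleK_inv. Qed.

Let F s n : R := \sum_(0 <= k < n) c s k.

Let FS s n : F s n.+1 = F s n + c s n.
Proof. by rewrite /F big_nat_recr. Qed.

Let F_mono s m n : (m <= n)%N -> F s m <= F s n.
Proof.
move=> /subnK <-; elim: (n - m)%N => [|k IH]; first by rewrite add0n.
by rewrite addSn FS (le_trans IH)// lerDl c_ge0.
Qed.

Let c_series s : (\sum_(k <oo) (c s k)%:E = 1)%E.
Proof.
rewrite nneseries_esumT; last by move=> n; rewrite lee_fin c_ge0.
rewrite -(trans_sum s).
rewrite (_ : \esum_(t in [set: S]) (trans s t)%:E =
   \esum_(t in [set: S]) (c s (pickle t))%:E)%E; last first.
  by apply: eq_esum => t _; rewrite cpickle.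
rewrite -(esum_image [set: S] pickle (fun k => (c s k)%:E)); last first.
  by move=> x y _ _; exact: (pcan_inj pickleK).
rewrite [RHS]esum_mkcond; apply: eq_esum => k _.
case: ifPn => // /negP nk; rewrite /c.
case E : (pickle_inv k) => [t|//]; exfalso; apply: nk.
rewrite inE; exists t => //.
by have := @pickle_invK S k; rewrite /ocancel E.
Qed.

Let F_le1 s n : F s n <= 1.
Proof.
rewrite -lee_fin -(c_series s) /F -sumEFin.
by apply: nneseries_lim_ge => k _; rewrite lee_fin c_ge0.
Qed.

Let F_gt s u : u < 1 -> exists n, u < F s n.
Proof.
move=> u1; apply: contrapT => /forallNP H.
have : (\sum_(k <oo) (c s k)%:E <= u%:E)%E.
  apply: lime_le.
    by apply: is_cvg_nneseries => n _ _; rewrite lee_fin c_ge0.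
  apply: nearW => n; rewrite sumEFin lee_fin leNgt; exact/negP/H.
by rewrite c_series lee_fin leNgt u1.
Qed.

Let lo s t := F s (pickle t).

Let in_cell s u t : Prop := lo s t <= u < lo s t + trans s t.

Let cell_ex s u : 0 <= u < 1 -> exists t, in_cell s u t.
Proof.
move=> /andP[u0 u1]; have H := F_gt s u1.
case: (ex_minnP H) => -[|n]; first by rewrite /F big_geq// ltNge u0.
move=> un Hmin.
have Fu : F s n <= u.
  by rewrite leNgt; apply/negP => /Hmin; rewrite ltnn.
move: (un); rewrite FS {1}/c.
have := @pickle_invK S n; case E : (pickle_inv n) => [t|] /= => [tn|_].
  by move=> ut; exists t; rewrite /in_cell /lo tn Fu.
by rewrite addr0 => /(le_lt_trans Fu); rewrite ltxx.
Qed.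

Let cell_uniq s u t t' : in_cell s u t -> in_cell s u t' -> t = t'.
Proof.
wlog tt' : t t' / (pickle t <= pickle t')%N.
  move=> H h h'; case/orP: (leq_total (pickle t) (pickle t')) => tt'.
    exact: H.
  exact/esym/H.
move=> /andP[_ h] /andP[h' _].
apply: (pcan_inj (@pickleK S)); apply/eqP; rewrite eqn_leq tt'/= leqNgt.
apply/negP => /(F_mono s); rewrite FS cpickle => h2.
by have := le_lt_trans (le_trans h2 h') h; rewrite ltxx.
Qed.

Let cell_gt0 s u t : in_cell s u t -> 0 < trans s t.
Proof. by move=> /andP[a b]; have := le_lt_trans a b; rewrite ltrDl. Qed.

Let next s u : S := xget s [set t | in_cell s u t].

Let nextP s u : 0 <= u < 1 -> in_cell s u (next s u).
Proof.
by move=> /(cell_ex s) h; rewrite /next; case: xgetP => // /forallNP.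
Qed.

Let step (x : S * R) : S * R :=
  let t := next x.1 x.2 in (t, (x.2 - lo x.1 t) / trans x.1 t).

Let gen s u : run M := fun n => (iter n step (s, u)).1.

Let genS s u n :
  gen s u n.+1 = gen (next s u) ((u - lo s (next s u)) / trans s (next s u)) n.
Proof. by rewrite /gen iterSr. Qed.

Let step_itv s u : 0 <= u < 1 ->
  0 <= (u - lo s (next s u)) / trans s (next s u) < 1.
Proof.
move=> /(nextP s) h; have p0 := cell_gt0 h; move: h => /andP[h1 h2].
by rewrite ler_pdivlMr// ltr_pdivrMr// mul0r mul1r subr_ge0 h1/= ltrBlDl.
Qed.

Let gen_cyl n (w : run M) : exists a, [/\ 0 <= a,
  a + \prod_(i < n) trans (w i) (w i.+1) <= 1 &
  forall u, 0 <= u < 1 -> (cylinder w n (gen (w 0%N) u) <->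
     a <= u < a + \prod_(i < n) trans (w i) (w i.+1))].
Proof.
elim: n w => [|n IH] w.
  exists 0; rewrite big_ord0 add0r; split=> // u u01; split=> // _ [|//].
  by [].
have [a [a0 a1 Ha]] := IH (fun i => w i.+1).
rewrite big_ord_recl.
rewrite (_ : \prod_(i < n) _ = \prod_(i < n) trans (w i.+1) (w i.+2)) //.
set p := \prod_(i < n) trans (w i.+1) (w i.+2) in a1 Ha *.
have p0 : 0 <= p by apply: prodr_ge0 => i _; exact: trans_ge0.
set q := trans (w ord0) _; have q0 : 0 <= q by exact: trans_ge0.
have lo0 : 0 <= lo (w 0%N) (w 1%N) by apply: sumr_ge0 => i _; exact: c_ge0.
have lo1 : lo (w 0%N) (w 1%N) + q <= 1.
  by have := F_le1 (w 0%N) (pickle (w 1%N)).+1; rewrite FS cpickle.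
exists (lo (w 0%N) (w 1%N) + q * a); split.
- by rewrite addr_ge0// mulr_ge0.
- rewrite -addrA -mulrDr (le_trans _ lo1)// lerD2l ler_piMr//.
move=> u u01.
have iffn : cylinder w n.+1 (gen (w 0%N) u) <-> next (w 0%N) u = w 1%N /\
    cylinder (fun i => w i.+1) n
      (gen (next (w 0%N) u) ((u - lo (w 0%N) (next (w 0%N) u)) /
         trans (w 0%N) (next (w 0%N) u))).
  split=> [h|[h1 h2]].
    split; first by have := h 1%N isT.
    by move=> i ilen; rewrite -genS; apply: h.
  move=> [|i] ilen //; rewrite genS; exact: h2.
rewrite iffn {iffn}; have nP := nextP (w 0%N) u01.
have u'01 := step_itv (w 0%N) u01.
split.
  move=> [e]; move: nP u'01; rewrite !e => nP u'01 /(Ha _ u'01).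
  have q_gt0 : 0 < q := cell_gt0 nP.
  rewrite ler_pdivlMr// ltr_pdivrMr// -/q => /andP[h1 h2].
  by apply/andP; split; lra.
move=> /andP[h1 h2].
have e : next (w 0%N) u = w 1%N.
  apply: (cell_uniq nP); rewrite /in_cell -/q; apply/andP; split.
    by rewrite (le_trans _ h1)// lerDl mulr_ge0.
  by rewrite (lt_le_trans h2)// -addrA -mulrDr lerD2l ler_piMr.
split=> //; move: nP u'01; rewrite !e => nP u'01; apply/(Ha _ u'01).
have q_gt0 : 0 < q := cell_gt0 nP.
rewrite ler_pdivlMr// ltr_pdivrMr// -/q; apply/andP; split; lra.
Qed.

Let unit_itv : set R := `[0, 1[%classic.

Let munit : measurable (unit_itv : set (measurableTypeR R)).
Proof. exact: measurable_itv. Qed.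

Let gen0 s (u : measurableTypeR R) : run_space M :=
  gen s (if 0 <= u < 1 then u else 0).

Let gen0_cyl s (w : run M) n : w 0%N = s -> exists a,
  [/\ 0 <= a, a + \prod_(i < n) trans (w i) (w i.+1) <= 1 &
   (gen0 s @^-1` cylinder w n) `&` unit_itv =
      `[a, a + \prod_(i < n) trans (w i) (w i.+1)[%classic].
Proof.
move=> <-; have [a [a0 a1 Ha]] := gen_cyl n w; exists a; split=> //.
apply/seteqP; split=> u /=; rewrite /gen0 /unit_itv/= !in_itv/=.
  by move=> [+ u01]; rewrite u01 => /(Ha _ u01).
move=> h; have u01 : 0 <= u < 1.
  by move: h => /andP[h1 h2]; rewrite (le_trans a0)//= (lt_le_trans h2).
by rewrite u01; split=> //; apply/(Ha _ u01).
Qed.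

Let gen0_measurable s : measurable_fun [set: measurableTypeR R] (gen0 s).
Proof.
refine (@measurability _ _ (measurableTypeR R) (run_space M) setT (gen0 s)
  (cylinders M) erefl _).
move=> _ [_ [w [n ->]] <-]; rewrite setTI.
set X := (X in measurable X).
have -> : X = (X `&` unit_itv) `|` (X `&` ~` unit_itv).
  by rewrite -setIUr setUCr setIT.
apply: measurableU.
  have [ws|/eqP ws] := eqVneq (w 0%N) s.
    by have [a [_ _ ->]] := gen0_cyl n ws; exact: measurable_itv.
  rewrite (_ : _ `&` _ = set0)//.
  by apply/seteqP; split=> // u [] /(_ 0%N isT) /esym.
have [g0|g0] := pselect (cylinder w n (gen s 0)).
  rewrite (_ : _ `&` _ = ~` unit_itv); first exact: measurableC.
  apply/seteqP; split=> [u []//|u uN]; split=> //; rewrite /X/= /gen0.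
  by case: ifPn => // u01; exfalso; apply: uN; rewrite /unit_itv/= in_itv.
rewrite (_ : _ `&` _ = set0)//.
apply/seteqP; split=> // u [] /=; rewrite /X /= /gen0 /unit_itv /= in_itv /=.
by case: ifPn.
Qed.

Definition gen_measure s : set (run_space M) -> \bar R :=
  pushforward (mrestr (@lebesgue_measure R) munit) (gen0 s).

Let gen_meas s : {measure set (run_space M) -> \bar R} :=
  measure_function_pushforward__canonical__measure_function_Measure
    (mrestr (@lebesgue_measure R) munit) (gen0_measurable s).

HB.instance Definition _ s := isMeasure.Build _ _ _ (gen_measure s)
  (measure0 (gen_meas s)) (measure_ge0 (gen_meas s))
  (@measure_semi_sigma_additive _ _ _ (gen_meas s)).

Let gen_measureT s : gen_measure s setT = 1%E.
Proof.
rewrite /gen_measure /pushforward /mrestr preimage_setT setTI.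
by rewrite /unit_itv lebesgue_measure_itv/= lte_fin ltr01 oppr0 adde0.
Qed.

HB.instance Definition _ s :=
  Measure_isProbability.Build _ _ _ (gen_measure s) (gen_measureT s).

Lemma run_measure_exists s :
  exists mu : probability (run_space M) R, is_run_measure s mu.
Proof.
exists (gen_measure s) => w n; rewrite /= /gen_measure /pushforward /mrestr.
have [ws|/eqP ws] := eqVneq (w 0%N) s.
  have [a [_ _ ->]] := gen0_cyl n ws; rewrite mul1r lebesgue_measure_itv/=.
  rewrite lte_fin ltrDl; case: ltP => [p0|p0].
    by rewrite -EFinB addrAC subrr add0r.
  congr EFin; apply/eqP; rewrite eq_le p0 andbT.
  by apply: prodr_ge0 => i _; exact: trans_ge0.
rewrite mul0r (_ : _ `&` _ = set0) ?measure0//.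
by apply/seteqP; split=> // u [] /(_ 0%N isT) /esym.
Qed.

Lemma run_measure_unique s (mu nu : probability (run_space M) R) :
  is_run_measure s mu -> is_run_measure s nu ->
  forall E : set (run_space M), measurable E -> mu E = nu E.
Proof.
move=> hmu hnu.
pose G : set (set (run_space M)) := cylinders M `|` [set set0].
pose g k : set (run_space M) := cylinder (fun=> odflt (init M) (unpickle k)) 0.
have sG : measurable = <<s G >> :> set (set (run_space M)).
  apply/seteqP; split; first by apply: sub_smallest2r => //; exact: subsetUl.
  apply: smallest_sub; first exact: smallest_sigma_algebra.
  by move=> C [|->]; [exact: sub_sigma_algebra|exact: measurable0].
have cylI (w w' : run M) n m : (n <= m)%N ->
    G (cylinder w n `&` cylinder w' m).
  move=> nm; have [ww|ww] := pselect (forall i, (i <= n)%N -> w i = w' i).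
    left; exists w', m; apply/seteqP; split=> [pi []//|pi h]; split=> // i ilen.
    by rewrite ww// h// (leq_trans ilen).
  right; apply/seteqP; split=> // pi [h h']; apply: ww => i ilen.
  by rewrite -h// h'// (leq_trans ilen).
apply: (measure_unique G g) => //.
- move=> C D [[w [n ->]]|->]; last by right; rewrite set0I.
  move=> [[w' [m ->]]|->]; last by right; rewrite setI0.
  by case/orP: (leq_total n m) => nm; [|rewrite setIC]; exact: cylI.
- by move=> k; left; exists (fun=> odflt (init M) (unpickle k)), 0%N.
- apply/seteqP; split=> // pi _; exists (pickle (pi 0%N)) => //.
  by move=> i; rewrite leqn0 => /eqP ->; rewrite pickleK.
- move=> C [[w [n ->]]|->]; last by rewrite !measure0.
  exact: etrans (hmu _ _) (esym (hnu _ _)).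
- by move=> k; rewrite [ltLHS](hmu _ _) ltry.
Qed.

End RunMeasureExists.

(* The standard measure on runs from s: by the two lemmas above it is the only
   probability measure with the prescribed values on cylinders. It charges
   only the runs that start in s and follow transitions of positive
   probability. *)
Definition run_measure (R : realType) (A : finType) (M : markov_chain R A)
    (s : state M) : probability (run_space M) R :=
  sval (cid (run_measure_exists s)).

Lemma run_measureP (R : realType) (A : finType) (M : markov_chain R A)
  (s : state M) : is_run_measure s (run_measure s).
Proof. exact: (svalP (cid (run_measure_exists s))). Qed.

Inductive cmp := CmpGe | CmpGt.

Definition cmp_holds (R : realType) (c : cmp) (x y : \bar R) : bool :=
  match c with CmpGe => (y <= x)%E | CmpGt => (y < x)%E end.

Definition unit_rat := {q : rat | 0 <= q <= 1}.

Definition one_rat : unit_rat := exist _ 1 isT.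

Inductive formula (A : finType) :=
| Atom (a : A)
| NegAtom (a : A)
| And (phi psi : formula A)
| Or (phi psi : formula A)
| Eventually (c : cmp) (q : unit_rat) (phi : formula A)
| Globally (c : cmp) (q : unit_rat) (phi : formula A).

Definition Globally1 (A : finType) (phi : formula A) : formula A :=
  Globally CmpGe one_rat phi.

Fixpoint sat (R : realType) (A : finType) (M : markov_chain R A) (s : state M)
    (phi : formula A) {struct phi} : Prop :=
  match phi with
  | Atom a => a \in label s
  | NegAtom a => a \notin label s
  | And phi1 phi2 => sat s phi1 /\ sat s phi2
  | Or phi1 phi2 => sat s phi1 \/ sat s phi2
  | Eventually c q phi1 =>
      cmp_holds c (run_measure s [set pi : run M | exists i, sat (pi i) phi1])
        (ratr (val q))%:E
  | Globally c q phi1 =>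
      cmp_holds c (run_measure s [set pi : run M | forall i, sat (pi i) phi1])
        (ratr (val q))%:E
  end.

Definition is_model (R : realType) (A : finType) (M : markov_chain R A)
    (phi : formula A) : Prop :=
  sat (init M) phi.

Definition satisfiable (R : realType) (A : finType) (phi : formula A) : Prop :=
  exists M : markov_chain R A, is_model M phi.

(* Literals, connectives and temporal operators count 1 each. Counting the
   negation signs or the encoding of the thresholds q can only increase this
   value. *)
Fixpoint fsize (A : finType) (phi : formula A) : nat :=
  match phi with
  | Atom _ | NegAtom _ => 1
  | And phi1 phi2 | Or phi1 phi2 => (fsize phi1 + fsize phi2).+1
  | Eventually _ _ phi1 | Globally _ _ phi1 => (fsize phi1).+1
  end.

Inductive FqG1or (A : finType) : formula A -> Prop :=
| FqG1or_atom a : FqG1or (Atom a)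
| FqG1or_neg a : FqG1or (NegAtom a)
| FqG1or_and phi psi : FqG1or phi -> FqG1or psi -> FqG1or (And phi psi)
| FqG1or_or phi psi : FqG1or phi -> FqG1or psi -> FqG1or (Or phi psi)
| FqG1or_F c q phi : FqG1or phi -> FqG1or (Eventually c q phi)
| FqG1or_G1 phi : FqG1or phi -> FqG1or (Globally1 phi).

Definition G1_FqG1or (A : finType) (phi : formula A) : Prop :=
  exists2 psi, FqG1or psi & phi = Globally1 psi.

(* Main.v *)
Require Import Defs.
From HB Require Import structures.
From mathcomp Require Import all_boot all_order all_algebra.
From mathcomp Require Import all_classical all_reals all_analysis.

Local Open Scope classical_set_scope.
Local Open Scope card_scope.

Set Implicit Arguments.
Unset Strict Implicit.
Unset Printing Implicit Defensive.

(* Whether [G_{=1} chi] holds at a state only depends on the states reachable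
   from it, and moving along transitions can only make more such formulas true.
   Hence some reachable state [s] is stable: a subformula that holds everywhere
   from some state reachable from [s] already holds everywhere from [s]. Choose
   for every subformula satisfied somewhere beyond [s] a state satisfying it,
   and arrange [s] and the chosen states on a deterministic cycle with their
   labels. Every formula of the fragment satisfied by a chosen state in the
   original chain is still satisfied on the cycle: a formula [F chi] of positive
   probability gets probability 1, and stability takes care of [G_{=1}]. *)

Import Order.TTheory GRing.Theory Num.Theory.
Local Open Scope ring_scope.

(** * Reachability and measures of reachability events *)

Section Reachability.
Variables (R : realType) (A : finType) (M : markov_chain R A).
Implicit Types (s t u : state M) (P : state M -> Prop).

(** A total sequence with a length, as in [cylinder], so that a path directly provides a cylinder of
    positive measure. *)
Definition reach s t : Prop := exists (w : run M) (n : nat),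
  [/\ w 0%N = s, w n = t &
      forall i, (i < n)%N -> 0 < trans (w i) (w i.+1)].

Lemma reach_refl s : reach s s.
Proof. by exists (fun=> s), 0%N. Qed.

Lemma reach_trans s t u : reach s t -> reach t u -> reach s u.
Proof.
move=> [w [n [w0 wn wP]]] [v [m [v0 vm vP]]].
exists (fun i => if (i <= n)%N then w i else v (i - n)%N), (n + m)%N; split=> //.
  (* At the end index [n + m] the first branch applies only if [m = 0], where both paths meet. *)
  case: leqP => [|_]; last by rewrite addKn.
  rewrite -{2}(addn0 n) leq_add2l leqn0 => /eqP m0.
  by move: vm; rewrite m0 addn0 v0 wn.
move=> i ilt; case: (ltngtP i n) => [ltin|ltni|ein].
- exact: wP.
- by rewrite subSn 1?ltnW//; apply: vP; rewrite -(ltn_add2l n) subnKC// ltnW.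
- rewrite ein wn -v0 subSnn; apply: vP.
  by move: ilt; rewrite ein -{1}(addn0 n) ltn_add2l.
Qed.

(** Runs may be uncountably many, but finite sequences of states are countably many, so the event
    splits into countably many cylinders. Its measurability and the nullity argument below both rest
    on this. *)
Lemma eventually_bigcup P : exists C : nat -> set (run_space M),
  [set pi : run M | exists i, P (pi i)] = \bigcup_k C k /\
  forall k, C k = set0 \/
    exists (w : run M) (n : nat), P (w n) /\ C k = cylinder w n.
Proof.
(* Lists are extended by [init M] to total sequences; the prefix of [pi] up to index [n] is captured
   by a list of length [n.+1]. *)
pose w (l : seq (state M)) : run M := nth (init M) l.
pose C k : set (run_space M) :=
  if unpickle k is Some (n, l) then
    if `[< P (w l n) >] then cylinder (w l) n else set0
  else set0.
exists C; split; last first.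
  move=> k; rewrite /C; case: unpickle => [[n l]|]; last by left.
  by case: asboolP => Pn; [right; exists (w l), n | left].
apply/seteqP; split=> [pi [n Pn]|pi [k _]].
  have E i : (i <= n)%N -> w (mkseq pi n.+1) i = pi i by move=> ?; rewrite /w nth_mkseq.
  exists (pickle (n, mkseq pi n.+1)) => //; rewrite /C pickleK.
  by rewrite E//; case: asboolP => // _ i /E ->.
rewrite /C; case: unpickle => [[n l]|//]; case: asboolP => // Pn /(_ n (leqnn n)) E.
by exists n; rewrite E.
Qed.

Lemma measurable_cylinder (w : run M) n :
  measurable (cylinder w n : set (run_space M)).
Proof. by apply: sub_sigma_algebra; exists w, n. Qed.

Lemma measurable_eventually P :
  measurable ([set pi : run M | exists i, P (pi i)] : set (run_space M)).
Proof.
have [C [-> CP]] := eventually_bigcup P.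
apply: bigcupT_measurable => k.
by case: (CP k) => [->|[w [n [_ ->]]]]; [exact: measurable0|exact: measurable_cylinder].
Qed.

Lemma measurable_globally P :
  measurable ([set pi : run M | forall i, P (pi i)] : set (run_space M)).
Proof.
rewrite (_ : mkset _ = ~` [set pi : run M | exists i, ~ P (pi i)]).
  by exact: measurableC (measurable_eventually (fun t => ~ P t)).
by apply/seteqP; split=> pi /= => [h [i]|/forallNP h i]; [apply; exact: h|exact: contrapT].
Qed.

(** A cylinder ending in [P] either starts outside [s] or contains a transition of probability 0,
    since otherwise its path would reach [P] from [s]. Countable unions of null sets are null. *)
Lemma run_measure_eventually0 s P : (forall t, reach s t -> ~ P t) ->
  run_measure s [set pi : run M | exists i, P (pi i)] = 0%E.
Proof.
move=> nP; have [C [-> CP]] := eventually_bigcup P.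
have mC k : measurable (C k).
  by case: (CP k) => [->|[w [n [_ ->]]]]; [exact: measurable0|exact: measurable_cylinder].
apply: measure_negligible; first exact: bigcupT_measurable.
apply: negligible_bigcup => k; apply/negligibleP => //.
case: (CP k) => [->|[w [n [Pn ->]]]]; first exact: measure0.
rewrite [LHS](run_measureP s w n).
have [ws|_] := eqVneq (w 0%N) s; last by rewrite mul0r.
have [[i /eqP ti]|/forallNP ti] :=
    pselect (exists i : 'I_n, trans (w i) (w i.+1) = 0).
  by rewrite (bigD1 i)//= (eqP ti) mul0r mulr0.
exfalso; apply: (nP (w n)) => //; exists w, n; split=> // i ltin.
by rewrite lt_def trans_ge0 andbT; apply/eqP; exact: (ti (Ordinal ltin)).
Qed.

(** A path to a state violating [P] has a cylinder of positive measure disjoint from the event, so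
    the two together would have mass above 1. *)
Lemma globally1_reach s P :
  (1 <= run_measure s [set pi : run M | forall i, P (pi i)])%E ->
  forall t, reach s t -> P t.
Proof.
move=> G1 t [w [n [w0 wn wP]]]; apply: contrapT => nPt.
set G : set (run_space M) := mkset _ in G1.
have mG : measurable G by exact: measurable_globally.
have mC := measurable_cylinder w n.
have GC0 : G `&` cylinder w n = set0.
  by apply/seteqP; split=> // pi [/(_ n) Pn /(_ n (leqnn n)) E]; apply: nPt; rewrite -wn -E.
have := probability_le1 (run_measure s) (measurableU _ _ mG mC).
rewrite measureU//; apply/negP; rewrite -ltNge.
rewrite (lt_le_trans _ (leeD2r _ G1))//.
rewrite [X in (_ + X)%E](run_measureP s w n) w0 eqxx mul1r -EFinD lte_fin ltrDl.
by apply: prodr_gt0 => i _; exact: wP.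
Qed.

End Reachability.

(** * Properties holding for all subformulas *)

Section Subformulas.
Variable A : finType.

Fixpoint all_subformulas (P : formula A -> Prop) (psi : formula A) : Prop :=
  P psi /\ match psi with
  | Atom _ | NegAtom _ => True
  | And chi1 chi2 | Or chi1 chi2 =>
      all_subformulas P chi1 /\ all_subformulas P chi2
  | Eventually _ _ chi | Globally _ _ chi => all_subformulas P chi
  end.

Lemma all_subformulas_self P psi : all_subformulas P psi -> P psi.
Proof. by case: psi => [?|?|? ?|? ?|? ? ?|? ? ?] []. Qed.

Lemma sub_all_subformulas (P Q : formula A -> Prop) psi :
  (forall chi, P chi -> Q chi) ->
  all_subformulas P psi -> all_subformulas Q psi.
Proof.
move=> PQ; elim: psi => /= [a|a|c1 IH1 c2 IH2|c1 IH1 c2 IH2|? ? c IH|? ? c IH].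
- by move=> [/PQ].
- by move=> [/PQ].
- by move=> [/PQ ? [/IH1 ? /IH2 ?]].
- by move=> [/PQ ? [/IH1 ? /IH2 ?]].
- by move=> [/PQ ? /IH].
- by move=> [/PQ ? /IH].
Qed.

End Subformulas.

(** * Choice of a stable state and of witnesses *)

Section Selection.
Variables (R : realType) (A : finType) (M : markov_chain R A).
Implicit Types (s t u : state M) (chi psi : formula A).

Definition always s chi : Prop := forall u, reach s u -> sat u chi.

(** [always] persists along [reach] in any case; stability says that it cannot be gained later
    either. *)
Definition stable s chi : Prop :=
  forall t, reach s t -> always t chi -> always s chi.

Definition covered (l : seq (state M)) s chi : Prop :=
  forall u, reach s u -> sat u chi -> exists2 t, t \in l & sat t chi.

Lemma always_reach s t chi : reach s t -> always s chi -> always t chi.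
Proof. by move=> st h u tu; apply: h; exact: reach_trans tu. Qed.

Lemma stable_reach s t chi : reach s t -> stable s chi -> stable t chi.
Proof.
move=> st h u tu au; apply: (always_reach st); apply: h au.
exact: reach_trans tu.
Qed.

(** If some reachable state has [always] for [chi], that state is stable; otherwise [s] is stable
    vacuously. *)
Lemma ex_stable1 s chi : exists2 t, reach s t & stable t chi.
Proof.
have [[t [st at_]]|/forallNP h] := pselect (exists t, reach s t /\ always t chi).
  by exists t => // u tu _.
by exists s; [exact: reach_refl|move=> t st at_; case: (h t)].
Qed.

(** Stability survives along [reach], so the subformulas are made stable one after another by moving
    further on. *)
Lemma ex_stable s psi :
  exists2 t, reach s t & all_subformulas (stable t) psi.
Proof.
have up t u chi : reach t u ->
    all_subformulas (stable t) chi -> all_subformulas (stable u) chi.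
  by move=> tu; apply: sub_all_subformulas => ?; exact: stable_reach.
elim: psi s => [a|a|c1 IH1 c2 IH2|c1 IH1 c2 IH2|c q c1 IH|c q c1 IH] s.
- by have [t st ht] := ex_stable1 s (Atom a); exists t.
- by have [t st ht] := ex_stable1 s (NegAtom a); exists t.
- have [t st ht] := ex_stable1 s (And c1 c2).
  have [u tu hu] := IH1 t; have [v uv hv] := IH2 u.
  have tv := reach_trans tu uv.
  exists v; first exact: reach_trans tv.
  by split; [exact: stable_reach ht|split=> //; exact: up hu].
- have [t st ht] := ex_stable1 s (Or c1 c2).
  have [u tu hu] := IH1 t; have [v uv hv] := IH2 u.
  have tv := reach_trans tu uv.
  exists v; first exact: reach_trans tv.
  by split; [exact: stable_reach ht|split=> //; exact: up hu].
- have [t st ht] := ex_stable1 s (Eventually c q c1); have [u tu hu] := IH t.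
  exists u; first exact: reach_trans tu.
  by split=> //; exact: stable_reach ht.
- have [t st ht] := ex_stable1 s (Globally c q c1); have [u tu hu] := IH t.
  exists u; first exact: reach_trans tu.
  by split=> //; exact: stable_reach ht.
Qed.

Lemma covered_sub (l l' : seq (state M)) s chi :
  {subset l <= l'} -> covered l s chi -> covered l' s chi.
Proof. by move=> ll' h u su /(h u su)[t /ll' ? ?]; exists t. Qed.

Lemma ex_covered1 s chi : exists l : seq (state M),
  [/\ (size l <= 1)%N, forall t, t \in l -> reach s t & covered l s chi].
Proof.
have [[t [st tchi]]|/forallNP h] :=
    pselect (exists t, reach s t /\ sat t chi).
  exists [:: t]; split=> // [u|u _ _]; first by rewrite inE => /eqP ->.
  by exists t => //; rewrite inE.
by exists [::]; split=> // u su uchi; case: (h u).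
Qed.

(** At most one witness is taken per occurrence of a subformula, whence the bound [fsize psi]. *)
Lemma ex_covered s psi : exists l : seq (state M),
  [/\ (size l <= fsize psi)%N, forall t, t \in l -> reach s t &
      all_subformulas (covered l s) psi].
Proof.
have subl (l l' : seq (state M)) chi : {subset l <= l'} ->
    all_subformulas (covered l s) chi -> all_subformulas (covered l' s) chi.
  by move=> ll'; apply: sub_all_subformulas => ?; exact: covered_sub.
have incl (l l' : seq (state M)) : {subset l <= l ++ l'}.
  by move=> x xl; rewrite mem_cat xl.
have incr (l l' : seq (state M)) : {subset l' <= l ++ l'}.
  by move=> x xl; rewrite mem_cat xl orbT.
have rcat (l l' : seq (state M)) : (forall t, t \in l -> reach s t) ->
    (forall t, t \in l' -> reach s t) -> forall t, t \in l ++ l' -> reach s t.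
  by move=> h h' t; rewrite mem_cat => /orP[/h|/h'].
elim: psi => [a|a|c1 [l1 [z1 r1 h1]] c2 [l2 [z2 r2 h2]]
             |c1 [l1 [z1 r1 h1]] c2 [l2 [z2 r2 h2]]
             |c q c1 [l1 [z1 r1 h1]]|c q c1 [l1 [z1 r1 h1]]].
- by have [l [? ? ?]] := ex_covered1 s (Atom a); exists l.
- by have [l [? ? ?]] := ex_covered1 s (NegAtom a); exists l.
- have [l [z r h]] := ex_covered1 s (And c1 c2).
  exists (l ++ (l1 ++ l2)); split.
  + by rewrite !size_cat; exact: leq_add z (leq_add z1 z2).
  + exact: (rcat _ _ r (rcat _ _ r1 r2)).
  + split; first exact: covered_sub h.
    by split; apply: (subl _ _ _ (incr _ _)); [apply: subl h1|apply: subl h2].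
- have [l [z r h]] := ex_covered1 s (Or c1 c2).
  exists (l ++ (l1 ++ l2)); split.
  + by rewrite !size_cat; exact: leq_add z (leq_add z1 z2).
  + exact: (rcat _ _ r (rcat _ _ r1 r2)).
  + split; first exact: covered_sub h.
    by split; apply: (subl _ _ _ (incr _ _)); [apply: subl h1|apply: subl h2].
- have [l [z r h]] := ex_covered1 s (Eventually c q c1).
  exists (l ++ l1); split; first by rewrite size_cat; exact: leq_add z z1.
    exact: rcat.
  by split; [exact: covered_sub h|apply: subl h1].
- have [l [z r h]] := ex_covered1 s (Globally c q c1).
  exists (l ++ l1); split; first by rewrite size_cat; exact: leq_add z z1.
    exact: rcat.
  by split; [exact: covered_sub h|apply: subl h1].
Qed.

End Selection.

(** * Deterministic cycles *)

Section Cycle.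
Variables (R : realType) (A : finType) (n : nat) (lab : 'I_n.+1 -> {set A}).

(** [inZp] reduces modulo [n.+1], so the last state leads back to [ord0]. *)
Let ctrans (i j : 'I_n.+1) : R := (j == inZp i.+1)%:R.

Let ctrans_itv i j : 0 <= ctrans i j <= 1.
Proof. by rewrite /ctrans; case: eqP => _; rewrite ?lexx ler01. Qed.

Let ctrans_sum i : \esum_(j in [set: 'I_n.+1]) (ctrans i j)%:E = 1%E.
Proof.
rewrite -[RHS](@esum_set1 R _ (inZp i.+1 : 'I_n.+1) (fun=> 1%E))//.
rewrite [RHS]esum_mkcond; apply: eq_esum => j _; rewrite /ctrans.
by have [->|/eqP ne] := eqVneq; [rewrite mem_set|rewrite memNset].
Qed.

Definition cycle_chain : markov_chain R A :=
  @MarkovChain R A 'I_n.+1 ctrans ord0 lab ctrans_itv ctrans_sum.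

Definition cycle_run (i : 'I_n.+1) : run cycle_chain := fun k => inZp (i + k).

Lemma run_measure_cycle (i : state cycle_chain) k :
  run_measure i (cylinder (cycle_run i) k) = 1%E.
Proof.
rewrite [LHS](run_measureP i (cycle_run i) k).
rewrite {1}/cycle_run addn0 valZpK eqxx mul1r big1// => j _.
rewrite /= /ctrans /cycle_run (_ : _ == _)//.
by apply/eqP/val_inj; rewrite /= -(addn1 (_ %% _)%N) modnDml addn1 addnS.
Qed.

(** Almost every run from [i] follows [cycle_run i] for any given finite time, and this run meets
    every state. *)
Lemma cycle_eventually (P : state cycle_chain -> Prop) (i j : state cycle_chain) :
  P j -> run_measure i [set pi : run cycle_chain | exists k, P (pi k)] = 1%E.
Proof.
move=> Pj; apply/eqP; rewrite eq_le probability_le1; last exact: measurable_eventually.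
(* [n.+1 - i] steps lead from [i] to [ord0] and [j] more to [j], whichever of the two is larger. *)
pose k := (n.+1 - i + j)%N.
rewrite -[leLHS](run_measure_cycle i k); apply: le_measure; rewrite ?inE.
- exact: measurable_cylinder.
- exact: measurable_eventually.
move=> pi /(_ k (leqnn k)) E; exists k; rewrite E /cycle_run.
rewrite (_ : inZp _ = j)//; apply/val_inj => /=.
by rewrite /k addnA subnKC 1?ltnW// modnDl modn_small.
Qed.

End Cycle.

Lemma cmp_holds_ge (R : realType) c (x y z : \bar R) :
  (x <= y)%E -> cmp_holds c x z -> cmp_holds c y z.
Proof.
by case: c => /= xy h; [exact: le_trans xy|exact: lt_le_trans xy].
Qed.

(** * Transfer of satisfaction to the cycle *)

Section Transfer.
Variables (R : realType) (A : finType) (M : markov_chain R A).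
Variables (s : state M) (l : seq (state M)).
Hypothesis sl : forall t, t \in l -> reach s t.

(** With [s] in front, the cycle is nonempty even when [l] is empty. *)
Definition rep (i : 'I_(size l).+1) : state M := nth s (s :: l) i.

Definition selection_cycle : markov_chain R A :=
  cycle_chain R (fun i => label (rep i)).

Lemma reach_rep i : reach s (rep i).
Proof.
rewrite /rep; have := mem_nth s (ltn_ord i : i < size (s :: l))%N.
by rewrite inE => /orP[/eqP ->|/sl//]; exact: reach_refl.
Qed.

(** One direction suffices because negation occurs only at literals: the cycle may satisfy more than
    the original chain. *)
Lemma sat_selection_cycle psi : FqG1or psi ->
  all_subformulas (stable s) psi ->
  all_subformulas (covered l s) psi ->
  forall i : state selection_cycle, sat (rep i) psi -> sat i psi.
Proof.
elim=> {psi} [a|a|c1 c2 _ IH1 _ IH2|c1 c2 _ IH1 _ IH2|c q chi _ IH|chi _ IH] //=.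
- by move=> [_ [a1 a2]] [_ [b1 b2]] i [? ?]; split; [exact: IH1|exact: IH2].
- by move=> [_ [a1 a2]] [_ [b1 b2]] i [?|?]; [left; exact: IH1|right; exact: IH2].
- move=> [_ a1] [_ b1] i.
  (* For any threshold it is enough that the probability does not decrease: it becomes 1 if [chi] is
     reachable from [rep i], and was 0 otherwise. *)
  have [[t [it tchi]]|/forallNP h] :=
      pselect (exists t, reach (rep i) t /\ sat t chi).
    have [u ul uchi] :=
      all_subformulas_self b1 t (reach_trans (reach_rep i) it) tchi.
    have ul' : (index u (s :: l) < (size l).+1)%N by rewrite index_mem inE ul orbT.
    rewrite (@cycle_eventually _ _ _ _ (fun k => sat k chi) i (Ordinal ul')).
      apply: cmp_holds_ge; apply: probability_le1.
      exact: (measurable_eventually (fun t => sat t chi)).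
    by apply: IH => //; rewrite /rep nth_index// inE ul orbT.
  rewrite (@run_measure_eventually0 _ _ _ _ (fun t => sat t chi)).
    exact/cmp_holds_ge/measure_ge0.
  by move=> t it tchi; apply: (h t).
- move=> [_ a1] [_ b1] i; rewrite rmorph1 => /(@globally1_reach _ _ _ _ (fun t => sat t chi)) h.
  (* Stability carries [always] back from [rep i] to [s], and thus to every state represented on the
     cycle, including those not reachable from [rep i] in [M]. *)
  have al : always s chi by apply: (all_subformulas_self a1) (reach_rep i) h.
  rewrite (_ : mkset _ = setT) ?probability_setT//.
  by apply/seteqP; split=> // pi _ k; apply: IH => //; exact/al/reach_rep.
Qed.

End Transfer.

Theorem theorem4 (R : realType) (A : finType) (phi : formula A) :
  G1_FqG1or phi -> satisfiable R phi ->
  exists M : markov_chain R A,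
    is_model M phi /\ [set: state M] #<= `I_(fsize phi).
Proof.
move=> [psi fpsi ->] [M]; rewrite /is_model /= rmorph1.
move=> /(@globally1_reach _ _ _ _ (fun t => sat t psi)) Mpsi.
have [s is_ hs] := ex_stable (init M) psi.
have [l [zl rl hl]] := ex_covered s psi.
have sat_s := sat_selection_cycle rl fpsi hs hl.
exists (selection_cycle s l); split; last first.
  (* The cycle has [(size l).+1] states; the one added for [s] is paid for by the outer
     [Globally1]. *)
  by rewrite -(card_le_eql card_II) card_le_II ltnS.
rewrite (_ : mkset _ = setT) ?probability_setT//.
apply/seteqP; split=> // pi _ k; apply: sat_s; apply: Mpsi.
exact: reach_trans is_ (reach_rep rl _).
Qed.
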